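(* Let $G$ be a finite nilpotent group of odd order and let $\mathcal{O}$ be a conjugacy class in $G$, regarded as a rack with the operation $x\triangleright y=xyx^{-1}$. Then $\mathcal{O}$ is either of type C or else an abelian rack.
   Context: A rack is a non-empty set $X$ with a self-distributive operation $\triangleright:X\times X\to X$ (i.e. $x\triangleright(y\triangleright z)=(x\triangleright y)\triangleright(x\triangleright z)$) such that $\varphi_x:=x\triangleright\underline{\ \ }$ is bijective for every $x\in X$. A rack $X$ is abelian if $x\triangleright y=y$ for all $x,y\in X$. For a rack $Y$, $\operatorname{Inn}Y$ is the subgroup of the group of rack automorphisms of $Y$ generated by all $\varphi_y$, $y\in Y$, and $\mathcal{O}^{\operatorname{Inn}Y}_{r}$ denotes the orbit of $r\in Y$ under $\operatorname{Inn}Y$. A rack $Y$ is decomposable if it is a disjoint union $Y=R\coprod S$ of two non-empty subracks with $R\triangleright S=S$ and $S\triangleright R=R$. A finite rack $X$ is of type C when there are a decomposable subrack $Y=R\coprod S$ of $X$ and elements $r\in R$, $s\in S$ such that: (1) $r\triangleright s\neq s$ (hence $s\triangleright r\neq r$); (2) $R=\mathcal{O}^{\operatorname{Inn}Y}_{r}$ and $S=\mathcal{O}^{\operatorname{Inn}Y}_{s}$; (3) $\min\{|R|,|S|\}>2$ or $\max\{|R|,|S|\}>4$. *)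

(* Defs.v *)
From HB Require Import structures.
From mathcomp Require Import all_boot all_fingroup all_solvable.

Set Implicit Arguments.
Unset Strict Implicit.
Unset Printing Implicit Defensive.

Import GroupScope.

HB.mixin Record isRack (X : Type) := {
  rack_op : X -> X -> X;
  rack_nonempty : inhabited X;
  rack_distr : forall x y z : X,
    rack_op x (rack_op y z) = rack_op (rack_op x y) (rack_op x z);
  rack_op_bij : forall x : X, bijective (rack_op x)
}.

#[short(type="rackType")]
HB.structure Definition Rack := { X of isRack X }.

#[short(type="finRackType")]
HB.structure Definition FinRack := { X of isRack X & Finite X }.

Notation "x ▷ y" := (rack_op x y) (at level 40, left associativity).

Definition abelian_rack (X : rackType) : Prop := forall x y : X, x ▷ y = y.

Section Inner.
Variable X : finRackType.

Lemma rack_op_inj (x : X) : injective (rack_op x).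
Proof. exact: bij_inj (rack_op_bij x). Qed.

Definition rack_perm (x : X) : {perm X} := perm (@rack_op_inj x).

Definition rack_aut : {set {perm X}} :=
  [set f : {perm X} | [forall x, forall y, f (x ▷ y) == f x ▷ f y]].

Lemma rack_aut_group_set : group_set rack_aut.
Proof.
apply/group_setP; split=> [|f g].
  by rewrite inE; apply/forallP=> x; apply/forallP=> y; rewrite !perm1.
rewrite !inE => /forallP fP /forallP gP.
apply/forallP=> x; apply/forallP=> y; rewrite !permM.
by rewrite (eqP (forallP (fP x) y)) (eqP (forallP (gP (f x)) (f y))).
Qed.

Canonical rack_aut_group := group rack_aut_group_set.

Definition Inn : {group {perm X}} := <<[set rack_perm x | x : X]>>%G.

Lemma Inn_sub_aut : Inn \subset rack_aut.
Proof.
rewrite gen_subG; apply/subsetP=> _ /imsetP[x _ ->]; rewrite inE.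
by apply/forallP=> y; apply/forallP=> z; rewrite !permE rack_distr.
Qed.

End Inner.

Section Subrack.
Variable X : finRackType.

(* As [rack_op x] is injective, it restricts to a bijection of [Y] exactly
   when the image of [Y] is [Y]. *)
Definition is_subrack (Y : {set X}) : bool :=
  (Y != set0) && [forall x in Y, rack_op x @: Y == Y].

Record subrack := Subrack {
  subrack_set :> {set X};
  subrackP : is_subrack subrack_set
}.

Definition subrack_rack (Y : subrack) : Type := {x : X | x \in subrack_set Y}.

Section Instance.
Variable Y : subrack.
HB.instance Definition _ := Finite.on (subrack_rack Y).

Lemma subrack_closed (x y : X) : x \in (Y : {set X}) -> y \in (Y : {set X}) ->
  x ▷ y \in (Y : {set X}).
Proof.
have /andP[_ /forall_inP YP] := subrackP Y.
by move=> /YP/eqP {2}<- yY; apply: imset_f.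
Qed.

Definition subrack_op (x y : subrack_rack Y) : subrack_rack Y :=
  exist _ (val x ▷ val y) (subrack_closed (valP x) (valP y)).

Lemma subrack_nonempty : inhabited (subrack_rack Y).
Proof.
have /andP[/set0Pn[x xY] _] := subrackP Y.
by constructor; exists x.
Qed.

Lemma subrack_distr (x y z : subrack_rack Y) :
  subrack_op x (subrack_op y z) = subrack_op (subrack_op x y) (subrack_op x z).
Proof. by apply: val_inj; rewrite /= rack_distr. Qed.

Lemma subrack_op_bij (x : subrack_rack Y) : bijective (subrack_op x).
Proof.
apply: injF_bij => y z /(congr1 val) /= /rack_op_inj yz.
exact: val_inj.
Qed.

HB.instance Definition _ := isRack.Build (subrack_rack Y)
  subrack_nonempty subrack_distr subrack_op_bij.

End Instance.
End Subrack.

Definition decomposition (Y : finRackType) (R S : {set Y}) : Prop :=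
  [/\ R :|: S = [set: Y], [disjoint R & S], is_subrack R, is_subrack S
    & @rack_op Y @2: (R, S) = S /\ @rack_op Y @2: (S, R) = R].

Definition type_C (X : finRackType) : Prop :=
  exists (Y : subrack X) (R S : {set subrack_rack Y}) (r s : subrack_rack Y),
    decomposition R S /\
    [/\ r \in R, s \in S,
        r ▷ s <> s,
        R = orbit 'P (Inn (subrack_rack Y)) r /\
        S = orbit 'P (Inn (subrack_rack Y)) s
      & 2 < minn #|R| #|S| \/ 4 < maxn #|R| #|S|].

Section Conjugation.
Variable gT : finGroupType.

(* An alias of [gT], so that the rack structure is not attached to [gT]. *)
Definition conj_rack : Type := gT.
HB.instance Definition _ := Finite.on conj_rack.

Definition conj_op (x y : conj_rack) : conj_rack :=
  ((x : gT) * (y : gT) * (x : gT)^-1)%g.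

Lemma conj_opE (x y : gT) : conj_op x y = y ^ x^-1.
Proof. by rewrite /conj_op conjgE invgK mulgA. Qed.

Lemma conj_nonempty : inhabited conj_rack.
Proof. by constructor; exact: (1 : gT). Qed.

Lemma conj_distr (x y z : conj_rack) :
  conj_op x (conj_op y z) = conj_op (conj_op x y) (conj_op x z).
Proof. by rewrite !conj_opE -!conjgM -conjVg -conjgC. Qed.

Lemma conj_op_bij (x : conj_rack) : bijective (conj_op x).
Proof. by apply: injF_bij => y z; rewrite !conj_opE; apply: conjg_inj. Qed.

HB.instance Definition _ := isRack.Build conj_rack
  conj_nonempty conj_distr conj_op_bij.

Lemma class_is_subrack (G : {group gT}) (O : {set gT}) :
  O \in classes G -> is_subrack (O : {set conj_rack}).
Proof.
case/imsetP=> a aG ->; apply/andP; split.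
  by apply/set0Pn; exists a; exact: class_refl.
apply/forall_inP=> x xa.
have xG : (x : gT) \in G by apply: subsetP (class_subG aG (subxx G)) _ xa.
rewrite eqEcard card_imset ?leqnn ?andbT; last exact: rack_op_inj.
apply/subsetP=> _ /imsetP[_ /imsetP[g gG ->] ->].
suff : conj_op x (a ^ g) \in a ^: G by [].
by rewrite conj_opE -conjgM; apply: imset_f; rewrite groupM ?groupV.
Qed.

Definition class_subrack (G : {group gT}) (O : {set gT})
  (clO : O \in classes G) : subrack conj_rack :=
  Subrack (class_is_subrack clO).

Definition class_rack (G : {group gT}) (O : {set gT})
  (clO : O \in classes G) : finRackType :=
  subrack_rack (class_subrack clO).

End Conjugation.

(* Main.v *)
(** Let [r], [s] be non-commuting elements of the class and [H = <r, s>]. The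
    subrack [Y = r^H ∪ s^H] generates [H], so the orbits of [Inn Y] on [Y] are
    the [H]-classes of [r] and [s]. These classes differ: [<r>] is proper in
    the nilpotent group [H], hence lies in a proper normal subgroup of [H],
    which contains every conjugate of [r] and so cannot contain [s]. Their
    cardinalities are larger than 1 and divide the odd number [#|H|], so both
    are at least 3. *)
Require Import Defs.
From HB Require Import structures.
From mathcomp Require Import all_boot all_fingroup all_solvable.

Set Implicit Arguments.
Unset Strict Implicit.
Unset Printing Implicit Defensive.

Import GroupScope.

(** By finiteness: each [rack_op x] is injective, so mapping [Y] into itself already makes it onto
    [Y]. *)
Lemma closed_is_subrack (X : finRackType) (Y : {set X}) (y : X) :
  y \in Y -> {in Y &, forall x z, x ▷ z \in Y} -> is_subrack Y.
Proof.
move=> yY clY; apply/andP; split; first by apply/set0Pn; exists y.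
apply/forall_inP=> x xY; rewrite eqEcard card_imset ?leqnn ?andbT.
  by apply/subsetP=> _ /imsetP[z zY ->]; apply: clY.
exact: rack_op_inj.
Qed.

Section InnOrbits.
Variable Y : finRackType.
Local Notation orb := (orbit 'P (Inn Y)).

Lemma Inn_orbit_op (x y z : Y) : (x ▷ y \in orb z) = (y \in orb z).
Proof.
have xI : rack_perm x \in Inn Y by apply/mem_gen/imset_f.
have -> : x ▷ y = 'P%act y (rack_perm x) by rewrite /= apermE permE.
exact: orbit_actr.
Qed.

Lemma Inn_orbit_subrack (y : Y) : is_subrack (orb y).
Proof.
by apply: (@closed_is_subrack _ _ y) => [|x z _]; rewrite ?orbit_refl ?Inn_orbit_op.
Qed.

(** Translation by [x] alone already covers [orb y]: it is onto [Y] and moves no element from one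
    orbit to another. *)
Lemma op_Inn_orbit (x y : Y) : @rack_op Y @2: (orb x, orb y) = orb y.
Proof.
apply/eqP; rewrite eqEsubset; apply/andP; split; apply/subsetP=> z.
  by case/imset2P=> u v _ vy ->; rewrite Inn_orbit_op.
have /andP[_ /forall_inP/(_ x (in_setT x))/eqP opT] : is_subrack [set: Y].
  by apply: (@closed_is_subrack _ _ y) => [|? ? _ _]; apply: in_setT.
have: z \in [set: Y] by rewrite inE.
rewrite -opT => /imsetP[w _ ->]; rewrite Inn_orbit_op => wy.
by apply: imset2_f => //; apply: orbit_refl.
Qed.

Lemma Inn_orbit_decomposition (r s : Y) :
  orb r :|: orb s = [set: Y] -> s \notin orb r -> decomposition (orb r) (orb s).
Proof.
move=> rsT nsr; split; rewrite ?Inn_orbit_subrack ?op_Inn_orbit //.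
rewrite -setI_eq0; apply/eqP/setP=> z; rewrite !inE; apply/negP=> /andP[zr zs].
by case/negP: nsr; rewrite -(orbit_eqP zr) orbit_sym.
Qed.

(** Along the rack morphism [v], translation by [x] becomes conjugation, so the generators of
    [Inn Y] act on the image as those of the group it generates. *)
Lemma imset_Inn_orbit (gT : finGroupType) (v : Y -> gT) (y : Y) :
  (forall x z, v (x ▷ z) = v z ^ (v x)^-1) ->
  v @: orb y = v y ^: <<v @: [set: Y]>>.
Proof.
move=> vop; set H := <<_>>.
have vH x : v x \in H by apply/mem_gen/imset_f.
apply/eqP; rewrite eqEsubset; apply/andP; split.
  (* The preimage of the class contains [y] and is stable under [Inn Y], so it contains the
     orbit. *)
  set C := v @^-1: (v y ^: H).
  suff actC : [acts Inn Y, on C | 'P].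
    apply/subsetP=> _ /imsetP[z zy ->].
    have yC : y \in C by rewrite inE class_refl.
    by move: yC; rewrite -(acts_sub_orbit y actC) => /subsetP/(_ z zy); rewrite inE.
  rewrite gen_subG; apply/subsetP=> _ /imsetP[x _ ->].
  rewrite !inE /=; apply/subsetP=> z; rewrite !inE /= apermE permE vop.
  by case/imsetP=> h hH ->; rewrite -conjgM memJ_class ?groupM ?groupV.
(* Conversely, the image of the orbit contains [v y] and is normalised by each [(v x)^-1], hence by
   [H]. *)
rewrite class_sub_norm; first by apply: imset_f; apply: orbit_refl.
rewrite gen_subG; apply/subsetP=> _ /imsetP[x _ ->].
rewrite -groupV inE; apply/subsetP=> _ /imsetP[_ /imsetP[z zy ->] ->].
by rewrite -vop; apply: imset_f; rewrite Inn_orbit_op.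
Qed.

End InnOrbits.

Lemma nilpotent_gen2_class (gT : finGroupType) (r s : gT) :
  nilpotent <<[set r; s]>> -> s \in r ^: <<[set r; s]>> -> commute r s.
Proof.
set H := <<_>> => nilH rs.
have [rH sH] : r \in H /\ s \in H by split; apply: mem_gen; rewrite !inE eqxx ?orbT.
have rsubH : <[r]> \subset H by rewrite cycle_subG.
(* If [<[r]>] is all of [H], then [s] is a power of [r]; otherwise a proper normal [K] contains [r]
   and its conjugate [s], hence [H], which is absurd. *)
case: (subnormalEr (nilpotent_subnormal nilH rsubH)) => [rEH | [K [rK nKH]]].
  by move: sH; rewrite -[H]rEH => /cycleP[i ->]; apply: commuteX.
case/andP=> _ /negP[]; rewrite gen_subG subUset !sub1set.
have {}rK : r \in K by rewrite -cycle_subG; apply: subnormal_sub rK.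
rewrite rK; by move: rs; apply: subsetP; rewrite class_sub_norm // normal_norm.
Qed.

(** The class size is the index of a centraliser, hence odd; if it were 1, then [y] would fix
    [x]. *)
Lemma odd_class_gt2 (gT : finGroupType) (H : {group gT}) (x y : gT) :
  odd #|H| -> y \in H -> ~ commute x y -> 2 < #|x ^: H|.
Proof.
move=> oddH yH nxy.
have : odd #|x ^: H| by rewrite -index_cent1; apply: dvdn_odd (dvdn_indexg _ _) oddH.
have : 0 < #|x ^: H| by apply/card_gt0P; exists x; apply: class_refl.
suff : #|x ^: H| != 1%N by case: #|_| => [|[|[|]]].
apply/cards1P=> -[z zP]; case: nxy.
have := class_refl H x; rewrite zP inE => /eqP xz.
have : x ^ y \in x ^: H by apply: memJ_class.
by rewrite zP inE -xz => /eqP/conjg_fixP/commgP.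
Qed.

Theorem theorem2p1 (gT : finGroupType) (G : {group gT}) (O : {set gT})
  (nilG : nilpotent G) (oddG : odd #|G|) (clO : O \in classes G) :
  type_C (class_rack clO) \/ abelian_rack (class_rack clO).
Proof.
pose X := class_rack clO.
have [/forallP abX | nabX] := boolP [forall x : X, forall y : X, x ▷ y == y].
  by right=> x y; apply/eqP; apply: (forallP (abX x)).
left; move: nabX; rewrite negb_forall => /existsP[a].
rewrite negb_forall => /existsP[b nab].
pose u (x : X) : gT := val x.
have uop (x y : X) : u (x ▷ y) = u y ^ (u x)^-1 by exact: conj_opE.
have u_inj : injective u by exact: val_inj.
have uG (x : X) : u x \in G.
  case/imsetP: (clO) (valP x) => g gG OE xO.
  by apply: subsetP (class_subG gG (subxx G)) _ _; rewrite -OE.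
have ncab : ~ commute (u a) (u b).
  move=> cab; case/eqP: nab; apply: u_inj; rewrite uop.
  by apply/conjg_fixP/commgP/commuteV/commute_sym.
pose H := <<[set u a; u b]>>%G.
have [aH bH] : u a \in H /\ u b \in H.
  by split; apply: mem_gen; rewrite !inE eqxx ?orbT.
have sHG : H \subset G by rewrite gen_subG subUset !sub1set !uG.
have oddH : odd #|H| by apply: oddSg oddG.
(* Defined by a condition on [u], this is a set of elements of [X] at once; that [u] maps it onto
   both classes follows later from [vorb]. *)
pose Y0 := [set x : X | u x \in u a ^: H :|: u b ^: H].
have sYH x : x \in Y0 -> u x \in H.
  by rewrite !inE => /orP[] /imsetP[h hH ->]; rewrite groupJ.
have aY : a \in Y0 by rewrite !inE class_refl.
have bY : b \in Y0 by rewrite !inE class_refl orbT.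
have subY : is_subrack Y0.
  apply: (closed_is_subrack aY) => x z /sYH xH; rewrite !inE uop.
  by case/orP=> /imsetP[h hH ->]; rewrite -conjgM !memJ_class ?orbT ?groupM ?groupV.
pose Y := Subrack subY.
pose r : subrack_rack Y := exist _ a aY; pose s : subrack_rack Y := exist _ b bY.
pose v (y : subrack_rack Y) : gT := u (val y).
have vop x y : v (x ▷ y) = v y ^ (v x)^-1 by exact: uop.
have v_inj : injective v by apply: inj_comp u_inj val_inj.
have genv : <<v @: [set: subrack_rack Y]>> = H.
  apply/eqP; rewrite eqEsubset !gen_subG; apply/andP; split.
    by apply/subsetP=> _ /imsetP[y _ ->]; apply: sYH (valP y).
  rewrite subUset !sub1set !mem_gen //; apply/imsetP; first by exists s.
  by exists r.
have vorb y : v @: orbit 'P (Inn (subrack_rack Y)) y = v y ^: H.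
  by rewrite imset_Inn_orbit // genv.
(* As [v] is injective, lying in one inner orbit amounts to conjugacy in [H]. *)
have in_orb y z : (z \in orbit 'P (Inn (subrack_rack Y)) y) = (v z \in v y ^: H).
  by rewrite -vorb mem_imset.
exists Y, (orbit 'P (Inn (subrack_rack Y)) r), (orbit 'P (Inn (subrack_rack Y)) s), r, s.
split.
  apply: Inn_orbit_decomposition.
    apply/setP=> y; rewrite !inE !in_orb.
    by have := valP y; rewrite !inE.
  rewrite in_orb; apply/negP=> /nilpotent_gen2_class cab.
  by apply: ncab; apply: cab; apply: nilpotentS nilG.
split; rewrite ?orbit_refl //.
  by move/(congr1 val)/eqP; apply/negP.
(* Orbits have the size of their [H]-classes; [u b] shows that the class of [u a] is not trivial,
   and vice versa. *)
left; rewrite -!(card_imset _ v_inj) !vorb leq_min.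
rewrite (odd_class_gt2 oddH bH) // (odd_class_gt2 oddH aH) //.
by move/commute_sym.
Qed.
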